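(* Let $A$ be the unital $*$-algebra \[ A=\mathbb{C}\langle x,x^*,y,y^*\mid x^*=x,\ x^2y=-y,\ y^*y=0\rangle \] and $\varepsilon\colon A\to\mathbb{C}$ the character with $\varepsilon(x)=\varepsilon(y)=0$. Then $(A,\varepsilon)$ has property (AC), but $H^2(A,\mathbb{C})\neq\{0\}$.
   Context: $A$ is the universal unital associative complex $*$-algebra with generators $x,y$ and the given relations (and their adjoints). A character is a non-zero $*$-homomorphism to $\mathbb{C}$. A pre-Hilbert space is a complex vector space $D$ with a positive definite inner product, linear in the second argument; $L(D)$ is the $*$-algebra of adjointable linear operators $D\to D$. For a unital $*$-representation $\pi\colon A\to L(D)$, a $\pi$-$\varepsilon$-cocycle is a linear map $\eta\colon A\to D$ with $\eta(ab)=\pi(a)\eta(b)+\eta(a)\varepsilon(b)$ for all $a,b\in A$. A Schürmann triple is a triple $(\pi,\eta,\psi)$ of such $\pi$, $\eta$ and a linear functional $\psi\colon A\to\mathbb{C}$ with $\psi(a^* )=\overline{\psi(a)}$ and $\varepsilon(a)\psi(b)-\psi(ab)+\psi(a)\varepsilon(b)=-\langle\eta(a^* ),\eta(b)\rangle$ for all $a,b\in A$. Property (AC): for every unital $*$-representation $\pi$ of $A$ on a pre-Hilbert space and every $\pi$-$\varepsilon$-cocycle $\eta$ there exists $\psi$ such that $(\pi,\eta,\psi)$ is a Schürmann triple. $H^2(A,\mathbb{C})$ is the second Hochschild cohomology with coefficients in the bimodule $\mathbb{C}$ with actions $a.z.b=\varepsilon(a)z\varepsilon(b)$: linear $\phi\colon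 A\otimes A\to\mathbb{C}$ with $\varepsilon(a)\phi(b\otimes c)-\phi(ab\otimes c)+\phi(a\otimes bc)-\phi(a\otimes b)\varepsilon(c)=0$ for all $a,b,c$, modulo those of the form $\phi(a\otimes b)=\varepsilon(a)\psi(b)-\psi(ab)+\psi(a)\varepsilon(b)$ with $\psi\colon A\to\mathbb{C}$ linear. *)

(* Defs.v *)
From HB Require Import structures.
From mathcomp Require Import all_boot all_order all_algebra.
From mathcomp Require Import sesquilinear generic_quotient.
From mathcomp Require Import boolp classical_sets reals.
From mathcomp Require Import complex.

Set Implicit Arguments.
Unset Strict Implicit.
Unset Printing Implicit Defensive.

Import Order.TTheory GRing.Theory Num.Theory Num.Def.
Local Open Scope ring_scope.
Local Open Scope quotient_scope.
Local Open Scope classical_set_scope.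

HB.mixin Record isStarAlgebra (C : numClosedFieldType) A
    of GRing.Algebra C A := {
  star : A -> A;
  starK : involutive star;
  starD : {morph star : a b / a + b};
  starZ : forall (c : C) (a : A), star (c *: a) = c^* *: star a;
  starM : forall a b : A, star (a * b) = star b * star a
}.

#[short(type="starAlgType")]
HB.structure Definition StarAlgebra (C : numClosedFieldType) :=
  {A of GRing.Algebra C A & isStarAlgebra C A}.

Section RegularStarAlgebra.
Variable C : numClosedFieldType.
Local Lemma regular_starK : involutive (conjC : C^o -> C^o).
Proof. exact: conjCK. Qed.
Local Lemma regular_starD : {morph (conjC : C^o -> C^o) : a b / a + b}.
Proof. by move=> a b; exact: rmorphD. Qed.
Local Lemma regular_starZ (c : C) (a : C^o) :
  conjC (c *: a : C^o) = c^* *: (conjC a : C^o) :> C^o.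
Proof. exact: rmorphM. Qed.
Local Lemma regular_starM (a b : C^o) : conjC (a * b) = conjC b * conjC a :> C^o.
Proof. by rewrite mulrC; exact: rmorphM. Qed.
HB.instance Definition _ := isStarAlgebra.Build C C^o
  regular_starK regular_starD regular_starZ regular_starM.
End RegularStarAlgebra.

Section StarAlgebraTheory.
Variables (C : numClosedFieldType) (A : starAlgType C).

Lemma star1 : star (1 : A) = 1.
Proof.
by rewrite -[LHS]mulr1 -[X in _ * X = _](@starK _ A) -starM mulr1 starK.
Qed.

Record is_unital_star_hom (B : starAlgType C) (f : A -> B) : Prop := {
  star_hom_linear : linear f;
  star_hom_mul : {morph f : a b / a * b};
  star_hom_one : f 1 = 1;
  star_hom_star : {morph f : a / star a}
}.

Record is_character (eps : A -> C) : Prop := {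
  character_scalar : scalar eps;
  character_mul : {morph eps : a b / a * b};
  character_star : forall a, eps (star a) = (eps a)^*;
  character_neq0 : exists a, eps a != 0
}.

End StarAlgebraTheory.

(* The universal unital *-algebra with generators x, y and the given relations:
   terms in x, y, modulo the equations that hold in every unital *-algebra
   containing two elements which satisfy the relations. Its universal property
   is [univ_alg_universal] below. *)

Definition relations (C : numClosedFieldType) (B : starAlgType C) (x y : B) :=
  [/\ star x = x, x ^+ 2 * y = - y & star y * y = 0].

Inductive term (C : Type) : Type :=
  | TX | TY
  | TConst of C
  | TAdd of term C & term C
  | TMul of term C & term C
  | TStar of term C.
Arguments TX {C}.
Arguments TY {C}.

Section UniversalAlgebra.
Variable C : numClosedFieldType.

HB.instance Definition _ := gen_eqMixin (term C).
HB.instance Definition _ := gen_choiceMixin (term C).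

Fixpoint eval (B : starAlgType C) (x y : B) (t : term C) : B :=
  match t with
  | TX => x
  | TY => y
  | TConst c => c%:A
  | TAdd t u => eval x y t + eval x y u
  | TMul t u => eval x y t * eval x y u
  | TStar t => star (eval x y t)
  end.

Definition term_equiv (t u : term C) : bool :=
  `[< forall (B : starAlgType C) (x y : B),
        relations x y -> eval x y t = eval x y u >].

Lemma term_equiv_refl : reflexive term_equiv.
Proof. by move=> t; apply/asboolP. Qed.

Lemma term_equiv_sym : symmetric term_equiv.
Proof. by move=> t u; apply/asboolP/asboolP => h B x y /h. Qed.

Lemma term_equiv_trans : transitive term_equiv.
Proof.
move=> u t v /asboolP h1 /asboolP h2; apply/asboolP => B x y r.
by rewrite h1 ?h2.
Qed.

Canonical term_equiv_rel :=
  EquivRel term_equiv term_equiv_refl term_equiv_sym term_equiv_trans.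

Definition univ_alg : Type := {eq_quot term_equiv}.
HB.instance Definition _ := Choice.on univ_alg.

Definition term_class (t : term C) : univ_alg := \pi_({eq_quot term_equiv}) t.
Definition term_repr (a : univ_alg) : term C :=
  repr (a : {eq_quot term_equiv}).

Definition univ_alg_lift (B : starAlgType C) (x y : B) (a : univ_alg) : B :=
  eval x y (term_repr a).

Lemma lift_class (B : starAlgType C) (x y : B) (t : term C) :
  relations x y -> univ_alg_lift x y (term_class t) = eval x y t.
Proof.
move=> r; have /asboolP : term_equiv (term_repr (term_class t)) t.
  rewrite /term_repr /term_class; exact/eqmodP/reprK.
by apply.
Qed.

Lemma univ_alg_ext (a b : univ_alg) :
  (forall (B : starAlgType C) (x y : B), relations x y ->
     univ_alg_lift x y a = univ_alg_lift x y b) -> a = b.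
Proof.
move=> h; rewrite -[a](@reprK _ {eq_quot term_equiv}).
by rewrite -[b](@reprK _ {eq_quot term_equiv}); apply/eqmodP/asboolP.
Qed.

Let c0 : univ_alg := term_class (TConst 0).
Let c1 : univ_alg := term_class (TConst 1).
Let cadd (a b : univ_alg) : univ_alg :=
  term_class (TAdd (term_repr a) (term_repr b)).
Let cmul (a b : univ_alg) : univ_alg :=
  term_class (TMul (term_repr a) (term_repr b)).
Let cscale (c : C) (a : univ_alg) : univ_alg :=
  term_class (TMul (TConst c) (term_repr a)).
Let copp (a : univ_alg) : univ_alg := cscale (-1) a.
Let cstar (a : univ_alg) : univ_alg := term_class (TStar (term_repr a)).

Section LiftOps.
Variables (B : starAlgType C) (x y : B).
Hypothesis r : relations x y.
Let l := univ_alg_lift x y.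

Local Lemma l0 : l c0 = 0.
Proof. by rewrite /l lift_class //= scale0r. Qed.
Local Lemma l1 : l c1 = 1.
Proof. by rewrite /l lift_class //= scale1r. Qed.
Local Lemma lD a b : l (cadd a b) = l a + l b.
Proof. by rewrite /l lift_class. Qed.
Local Lemma lM a b : l (cmul a b) = l a * l b.
Proof. by rewrite /l lift_class. Qed.
Local Lemma lZ c a : l (cscale c a) = c *: l a.
Proof. by rewrite /l lift_class //= -scalerAl mul1r. Qed.
Local Lemma lN a : l (copp a) = - l a.
Proof. by rewrite lZ scaleN1r. Qed.
Local Lemma lS a : l (cstar a) = star (l a).
Proof. by rewrite /l lift_class. Qed.
End LiftOps.

Let lE := (l0, l1, lD, lM, lN, lZ, lS).

Local Ltac by_lift :=
  repeat intro; apply: univ_alg_ext => ? ? ? ?; rewrite !lE //.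

Local Lemma caddA : associative cadd.
Proof. by by_lift; rewrite addrA. Qed.
Local Lemma caddC : commutative cadd.
Proof. by by_lift; rewrite addrC. Qed.
Local Lemma cadd0 : left_id c0 cadd.
Proof. by by_lift; rewrite add0r. Qed.
Local Lemma caddN : left_inverse c0 copp cadd.
Proof. by by_lift; rewrite addNr. Qed.
HB.instance Definition _ :=
  GRing.isZmodule.Build univ_alg caddA caddC cadd0 caddN.

Local Lemma cmulA : associative cmul.
Proof. by by_lift; rewrite mulrA. Qed.
Local Lemma cmul1l : left_id c1 cmul.
Proof. by by_lift; rewrite mul1r. Qed.
Local Lemma cmul1r : right_id c1 cmul.
Proof. by by_lift; rewrite mulr1. Qed.
Local Lemma cmulDl : left_distributive cmul cadd.
Proof. by by_lift; rewrite mulrDl. Qed.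
Local Lemma cmulDr : right_distributive cmul cadd.
Proof. by by_lift; rewrite mulrDr. Qed.

Lemma relations00 : relations (0 : C^o) (0 : C^o).
Proof. by split; rewrite ?mulr0 ?oppr0 //; exact: rmorph0. Qed.

Local Lemma c1_neq0 : c1 != 0 :> univ_alg.
Proof.
apply/eqP => /(congr1 (univ_alg_lift (0 : C^o) 0)).
rewrite (l1 relations00) (l0 relations00).
by move/eqP; rewrite oner_eq0.
Qed.

HB.instance Definition _ := GRing.Zmodule_isNzRing.Build univ_alg
  cmulA cmul1l cmul1r cmulDl cmulDr c1_neq0.

Local Lemma cscaleA a b v : cscale a (cscale b v) = cscale (a * b) v.
Proof. by by_lift; rewrite scalerA. Qed.
Local Lemma cscale1 : left_id 1 cscale.
Proof. by by_lift; rewrite scale1r. Qed.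
Local Lemma cscaleDr : right_distributive cscale +%R.
Proof. by move=> a u v; by_lift; rewrite scalerDr. Qed.
Local Lemma cscaleDl v : {morph cscale^~ v : a b / a + b}.
Proof. by by_lift; rewrite scalerDl. Qed.
HB.instance Definition _ := GRing.Zmodule_isLmodule.Build C univ_alg
  cscaleA cscale1 cscaleDr cscaleDl.

Local Lemma cscaleAl (a : C) (u v : univ_alg) : a *: (u * v) = (a *: u) * v.
Proof. by by_lift; rewrite scalerAl. Qed.
HB.instance Definition _ := GRing.Lmodule_isLalgebra.Build C univ_alg cscaleAl.

Local Lemma cscaleAr (a : C) (u v : univ_alg) : a *: (u * v) = u * (a *: v).
Proof. by by_lift; rewrite scalerAr. Qed.
HB.instance Definition _ := GRing.Lalgebra_isAlgebra.Build C univ_alg cscaleAr.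

Local Lemma cstarK : involutive cstar.
Proof. by by_lift; rewrite starK. Qed.
Local Lemma cstarD : {morph cstar : a b / a + b}.
Proof. by by_lift; rewrite starD. Qed.
Local Lemma cstarZ (c : C) (a : univ_alg) : cstar (c *: a) = c^* *: cstar a.
Proof. by by_lift; rewrite starZ. Qed.
Local Lemma cstarM (a b : univ_alg) : cstar (a * b) = cstar b * cstar a.
Proof. by by_lift; rewrite starM. Qed.
HB.instance Definition _ := isStarAlgebra.Build C univ_alg
  cstarK cstarD cstarZ cstarM.

Definition gen_x : univ_alg := term_class TX.
Definition gen_y : univ_alg := term_class TY.

Lemma gen_relations : relations gen_x gen_y.
Proof.
split; apply: univ_alg_ext => B x y r; have [r1 r2 r3] := r.
- by rewrite lS //= !lift_class.
- by rewrite lN // !lM //= !lift_class //= -expr2.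
- by rewrite lM //= lS //= !lift_class //= scale0r.
Qed.

Lemma term_class_eval (t : term C) : term_class t = eval gen_x gen_y t.
Proof.
elim: t => [||c|t IHt u IHu|t IHt u IHu|t IHt] //=.
- by apply: univ_alg_ext => B x y r; rewrite lZ // l1 // lift_class.
- by rewrite -IHt -IHu; apply: univ_alg_ext => B x y r; rewrite lD // !lift_class.
- by rewrite -IHt -IHu; apply: univ_alg_ext => B x y r; rewrite lM // !lift_class.
- by rewrite -IHt; apply: univ_alg_ext => B x y r; rewrite lS // !lift_class.
Qed.

Lemma univ_alg_universal (B : starAlgType C) (x y : B) : relations x y ->
  exists! f : univ_alg -> B,
    is_unital_star_hom f /\ (f gen_x = x /\ f gen_y = y).
Proof.
move=> r; exists (univ_alg_lift x y); split.
  split; last by rewrite !lift_class.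
  split.
  - by move=> c a b; rewrite lD // lZ.
  - by move=> a b; rewrite lM.
  - by rewrite l1.
  - by move=> a; rewrite lS.
move=> f [[flin fM f1 fS] [fx fy]]; apply: funext => a.
have fD : {morph f : u v / u + v}.
  by move=> u v; rewrite -[u]scale1r flin !scale1r.
have f0 : f 0 = 0 by apply: (@addIr _ (f 0)); rewrite -fD !add0r.
have fZ c u : f (c *: u) = c *: f u by rewrite -[c *: u]addr0 flin f0 addr0.
have fE t : f (eval gen_x gen_y t) = eval x y t.
  elim: t => [||c|t IHt u IHu|t IHt u IHu|t IHt] //=.
  - by rewrite fZ f1.
  - by rewrite fD IHt IHu.
  - by rewrite fM IHt IHu.
  - by rewrite fS IHt.
rewrite /univ_alg_lift -fE -term_class_eval; congr f.
exact: (@reprK _ {eq_quot term_equiv}).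
Qed.

Lemma univ_alg_character : exists eps : univ_alg -> C,
  is_character eps /\ (eps gen_x = 0 /\ eps gen_y = 0).
Proof.
have [f [[[flin fM f1 fS] fxy] _]] := univ_alg_universal relations00.
exists f; split=> //; split=> //; exists 1.
by rewrite f1 (oner_neq0 C).
Qed.

End UniversalAlgebra.

(* The library's forms [{dot D for conjC}] are linear in the first argument;
   [inner] is linear in the second one. *)
Definition inner (C : numClosedFieldType) (D : lmodType C)
    (ip : {dot D for conjC}) (u v : D) : C := ip v u.

Section SchurmannTriples.
Variables (C : numClosedFieldType) (A : starAlgType C) (eps : A -> C).
Variables (D : lmodType C) (ip : {dot D for conjC}).

(* [pi] is a unital *-homomorphism into the *-algebra of adjointable linear
   operators on D, whose operations are pointwise sum and scaling, composition
   and adjoint. *)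
Record is_star_rep (pi : A -> D -> D) : Prop := {
  rep_op_linear : forall a, linear (pi a);
  rep_linear : forall (c : C) a b u, pi (c *: a + b) u = c *: pi a u + pi b u;
  rep_mul : forall a b u, pi (a * b) u = pi a (pi b u);
  rep_one : forall u, pi 1 u = u;
  rep_adjoint : forall a u v, inner ip (pi a u) v = inner ip u (pi (star a) v)
}.

Record is_cocycle (pi : A -> D -> D) (eta : A -> D) : Prop := {
  cocycle_linear : linear eta;
  cocycle_mul : forall a b, eta (a * b) = pi a (eta b) + eps b *: eta a
}.

Record is_schurmann_triple (pi : A -> D -> D) (eta : A -> D) (psi : A -> C)
    : Prop := {
  triple_rep : is_star_rep pi;
  triple_cocycle : is_cocycle pi eta;
  triple_scalar : scalar psi;
  triple_hermitian : forall a, psi (star a) = (psi a)^*;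
  triple_coboundary : forall a b,
    eps a * psi b - psi (a * b) + psi a * eps b
      = - inner ip (eta (star a)) (eta b)
}.

End SchurmannTriples.

Definition property_AC (C : numClosedFieldType) (A : starAlgType C)
    (eps : A -> C) : Prop :=
  forall (D : lmodType C) (ip : {dot D for conjC})
         (pi : A -> D -> D) (eta : A -> D),
    is_star_rep ip pi -> is_cocycle eps pi eta ->
    exists psi : A -> C, is_schurmann_triple eps ip pi eta psi.

Section SecondHochschildCohomology.
Variables (C : numClosedFieldType) (A : starAlgType C) (eps : A -> C).

(* Linear maps A (x) A -> C are represented by bilinear maps A -> A -> C. *)
Definition hochschild_Z2 : set (A -> A -> C) :=
  [set phi | [/\ forall b, scalar (phi^~ b), forall a, scalar (phi a) &
     forall a b c,
       eps a * phi b c - phi (a * b) c + phi a (b * c) - phi a b * eps c = 0]].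

Definition hochschild_B2 : set (A -> A -> C) :=
  [set phi | exists2 psi : A -> C, scalar psi &
     forall a b, phi a b = eps a * psi b - psi (a * b) + psi a * eps b].

Definition hochschild_class (phi : A -> A -> C) : set (A -> A -> C) :=
  [set (fun a b => phi a b + beta a b) | beta in hochschild_B2].

(* The quotient space Z^2 / B^2, as the set of cosets of B^2. *)
Definition hochschild_H2 : set (set (A -> A -> C)) :=
  [set hochschild_class phi | phi in hochschild_Z2].

Definition hochschild_H2_zero : set (A -> A -> C) :=
  hochschild_class (fun _ _ => 0).

End SecondHochschildCohomology.

(* Main.v *)
From HB Require Import structures.
Require Import Defs.
From mathcomp Require Import all_boot all_order all_algebra.
From mathcomp Require Import sesquilinear generic_quotient.
From mathcomp Require Import boolp classical_sets reals.
From mathcomp Require Import complex ring.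

Import Order.TTheory GRing.Theory Num.Theory.
Local Open Scope ring_scope.
Local Open Scope quotient_scope.
Local Open Scope classical_set_scope.

(** Property (AC).  Let [eta] be a cocycle for a representation [pi].  Positivity
    of the inner product makes the generator [y] invisible: [star y * y = 0]
    gives [pi y = 0], and then [x ^+ 2 * y = - y] gives
    [pi x (pi x (eta y)) = - eta y], which is only possible for [eta y = 0]
    since [pi x] is symmetric; the adjoint relation kills [eta (star y)].  So
    [pi] and [eta] factor through the quotient map [symbol] onto the polynomials
    in one self-adjoint variable, where the coboundary condition with [a = x]
    reads [psi (x * q) = <eta x, eta q> + psi x * eps q].  Choosing [psi x = 0]
    forces [psi a = <eta x, eta q>], where [q] is the polynomial of [a] without
    its constant term, divided by the variable.  This is [potential], and
    [potential_schurmann] verifies that it completes the triple.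

    Non-vanishing of the second cohomology.  Without the star, the relations have
    non-trivial solutions: there is a multiplicative functional [chi] with
    [chi x = 'i], and [x ^+ 2 * y = - y] admits a derivation [eta] twisted by
    [chi] on the left and [eps] on the right with [eta y = 1]; its mirror image
    is a derivation [theta] with [theta (star y) = 1] ([twisted_derivations]).
    Their cup product [theta a * eta b] is a cocycle with value [1] at
    [(star y, y)], whereas a coboundary takes there the value
    [- psi (star y * y) = 0].

    The twisted derivations are matrix entries of representations that do not
    respect the star, while the universal property only speaks of
    star-homomorphisms.  [univ_alg_hom] bridges this by replacing the target
    algebra by its double, whose involution exchanges two copies. *)

Set Implicit Arguments.
Unset Strict Implicit.
Unset Printing Implicit Defensive.

(** * Generation of the universal algebra *)

Section Generation.
Variable C : numClosedFieldType.
Local Notation A := (univ_alg C).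
Local Notation x := (gen_x C).
Local Notation y := (gen_y C).

Lemma star_gen_x : star x = x.
Proof. by have [] := gen_relations C. Qed.

(** Terms are handled together with their adjoints, which pushes the star down
    to the generators. *)
Lemma univ_alg_ind (P : A -> Prop) :
  P x -> P y -> P (star y) -> (forall c : C, P c%:A) ->
  (forall a b, P a -> P b -> P (a + b)) ->
  (forall a b, P a -> P b -> P (a * b)) -> forall a, P a.
Proof.
move=> Px Py Pys Pc PD PM.
have Pt t : P (eval x y t) /\ P (star (eval x y t)).
  elim: t => [||c|t [IHt IHt'] u [IHu IHu']|t [IHt IHt'] u [IHu IHu']|t [IHt IHt']] /=.
  - by rewrite star_gen_x.
  - by [].
  - by rewrite starZ star1.
  - by rewrite starD; split; apply: PD.
  - by rewrite starM; split; apply: PM.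
  - by rewrite starK.
move=> a; have <- : term_class (term_repr a) = a
  by exact: (@reprK _ {eq_quot (@term_equiv C)}).
by rewrite term_class_eval; have [] := Pt (term_repr a).
Qed.
End Generation.

(** * Three star-algebras *)

Section StarInstances.
Variable C : numClosedFieldType.

Local Lemma conj_polyK : involutive (map_poly (@Num.conj C)).
Proof.
by move=> p; rewrite -map_poly_comp map_poly_id // => c _ /=; rewrite conjCK.
Qed.

Local Lemma conj_polyZ (c : C) (p : {poly C}) :
  map_poly Num.conj (c *: p) = c^* *: map_poly Num.conj p.
Proof. exact: linearZ_LR. Qed.

Local Lemma conj_polyM (p q : {poly C}) :
  map_poly Num.conj (p * q) = map_poly Num.conj q * map_poly Num.conj p.
Proof. by rewrite rmorphM mulrC. Qed.

HB.instance Definition _ := isStarAlgebra.Build C {poly C}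
  conj_polyK (rmorphD _) conj_polyZ conj_polyM.

Definition mx_adjoint (n : nat) (M : 'M[C]_n.+1) := map_mx Num.conj M^T.

Local Lemma mx_adjointK n : involutive (@mx_adjoint n).
Proof. by move=> M; apply/matrixP => i j; rewrite !mxE conjCK. Qed.

Local Lemma mx_adjointD n : {morph @mx_adjoint n : M N / M + N}.
Proof. by move=> M N; apply/matrixP => i j; rewrite !mxE rmorphD. Qed.

Local Lemma mx_adjointZ n (c : C) (M : 'M[C]_n.+1) :
  @mx_adjoint n (c *: M) = c^* *: @mx_adjoint n M.
Proof. by apply/matrixP => i j; rewrite !mxE rmorphM. Qed.

Local Lemma mx_adjointM n (M N : 'M[C]_n.+1) :
  @mx_adjoint n (M * N) = @mx_adjoint n N * @mx_adjoint n M.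
Proof. by rewrite /mx_adjoint -[M * N]/(M *m N) trmx_mul map_mxM. Qed.

HB.instance Definition _ n := isStarAlgebra.Build C 'M[C]_n.+1
  (@mx_adjointK n) (@mx_adjointD n) (@mx_adjointZ n) (@mx_adjointM n).

(** The product [M * M] carries two involutions; an alias keeps the one which
    exchanges the factors apart from the componentwise one. *)
Definition double (M : starAlgType C) : Type := (M * M)%type.

Section Double.
Variable M : starAlgType C.
HB.instance Definition _ := GRing.Algebra.on (double M).

Definition swap_star (u : double M) : double M := (star u.2, star u.1).

Local Lemma swap_starK : involutive swap_star.
Proof. by case=> a b; rewrite /swap_star /= !starK. Qed.

Local Lemma swap_starD : {morph swap_star : u v / u + v}.
Proof. by move=> [a b] [c d]; rewrite /swap_star /= !starD. Qed.

Local Lemma swap_starZ (c : C) (u : double M) :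
  swap_star (c *: u) = c^* *: swap_star u.
Proof. by case: u => a b; rewrite /swap_star /= !starZ. Qed.

Local Lemma swap_starM (u v : double M) :
  swap_star (u * v) = swap_star v * swap_star u.
Proof. by case: u v => [a b] [c d]; rewrite /swap_star /= !starM. Qed.

HB.instance Definition _ := isStarAlgebra.Build C (double M)
  swap_starK swap_starD swap_starZ swap_starM.
End Double.
End StarInstances.

(** * Homomorphisms that do not respect the star *)

Section NonStarRepresentations.
Variable C : numClosedFieldType.

Lemma star_zero (M : starAlgType C) : star (0 : M) = 0.
Proof. by apply: (@addIr _ (star 0)); rewrite -starD !add0r. Qed.

Lemma star_opp (M : starAlgType C) (a : M) : star (- a) = - star a.
Proof. by rewrite -scaleN1r starZ rmorphN1 scaleN1r. Qed.

(** In [double M] the element [(X, star X)] is self-adjoint for every [X], and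
    [(Y, star Z)] has adjoint [(Z, star Y)].  The second components satisfy the
    relations because they are the adjoints of the relations between [X], [Y]
    and [Z], so the first projection of the lift is the wanted homomorphism. *)
Lemma univ_alg_hom (M : starAlgType C) (X Y Z : M) :
  X ^+ 2 * Y = - Y -> Z * X ^+ 2 = - Z -> Z * Y = 0 ->
  exists f : univ_alg C -> M,
    [/\ linear f, {morph f : a b / a * b} & f 1 = 1] /\
    [/\ f (gen_x C) = X, f (gen_y C) = Y & f (star (gen_y C)) = Z].
Proof.
move=> XY ZX ZY.
pose x : double M := (X, star X); pose y : double M := (Y, star Z).
have rel : relations x y.
  have XY' : X * X * Y = - Y by rewrite -(expr2 X).
  have ZX' : star X * star X * star Z = - star Z.
    by rewrite -(starM X X) -(starM Z) -(expr2 X) ZX star_opp.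
  have ZY' : star Y * star Z = 0 by rewrite -(starM Z) ZY star_zero.
  split; [congr pair | rewrite expr2; congr pair | congr pair] => //.
    by rewrite /= starK.
  by rewrite /= starK.
have [g [[[glin gM g1 gS] [gx gy]] _]] := univ_alg_universal rel.
exists (fun a => (g a).1); split; split.
- by move=> c a b; rewrite glin.
- by move=> a b; rewrite gM.
- by rewrite g1.
- by rewrite gx.
- by rewrite gy.
- by rewrite gS gy /= starK.
Qed.

End NonStarRepresentations.

(** * Linearity of characters *)

Section Characters.
Variables (C : numClosedFieldType) (A : starAlgType C) (eps : A -> C).
Hypothesis eps_char : is_character eps.

Lemma character_one : eps 1 = 1.
Proof.
have [a na] := character_neq0 eps_char.
by apply: (mulIf na); rewrite -(character_mul eps_char) !mul1r.
Qed.

Lemma characterD a b : eps (a + b) = eps a + eps b.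
Proof. by rewrite -[a]scale1r (character_scalar eps_char) scale1r mul1r. Qed.

Lemma characterZ c a : eps (c *: a) = c * eps a.
Proof.
have e0 : eps 0 = 0.
  by apply: (@addIr _ (eps 0)); rewrite -characterD !add0r.
by rewrite -[c *: a]addr0 (character_scalar eps_char) e0 addr0.
Qed.
End Characters.

(** * A cocycle that is not a coboundary *)

Section NontrivialCocycle.
Variables (C : numClosedFieldType) (eps : univ_alg C -> C).
Hypotheses (eps_char : is_character eps).
Hypotheses (eps_x : eps (gen_x C) = 0) (eps_y : eps (gen_y C) = 0).
Local Notation A := (univ_alg C).
Local Notation x := (gen_x C).
Local Notation y := (gen_y C).

Lemma eps_star_y : eps (star y) = 0.
Proof. by rewrite (character_star eps_char) eps_y conjC0. Qed.

(** If a homomorphism into upper triangular 2 x 2 matrices has diagonal entries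
    [alpha] and [beta], then its off-diagonal entry [d] satisfies
    [d (a * b) = alpha a * d b + d a * beta b].  Here [f] has the diagonal
    [(chi, eps)] and [g] has the diagonal [(eps, chi)]. *)
Lemma twisted_derivations : exists chi eta theta : A -> C,
  [/\ scalar eta, scalar theta,
      forall a b, eta (a * b) = chi a * eta b + eta a * eps b,
      forall a b, theta (a * b) = eps a * theta b + theta a * chi b
    & theta (star y) = 1 /\ eta y = 1].
Proof.
pose E (i j : 'I_2) : 'M[C]_2 := delta_mx i j.
have EE i j k l : E i j * E k l = E i l *+ (j == k).
  by rewrite -mulmxE mul_delta_mx_cond.
have [f [[flin fM f1] [fx fy fy']]] : exists f : A -> 'M[C]_2,
    [/\ linear f, {morph f : a b / a * b} & f 1 = 1] /\
    [/\ f x = 'i *: E 0 0, f y = E 0 1 & f (star y) = 0].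
  apply: univ_alg_hom; rewrite ?mul0r ?oppr0 //.
  by rewrite exprZn sqrCi expr2 EE mulr1n -scalerAl EE mulr1n scaleN1r.
have [g [[glin gM g1] [gx gy gy']]] : exists g : A -> 'M[C]_2,
    [/\ linear g, {morph g : a b / a * b} & g 1 = 1] /\
    [/\ g x = 'i *: E 1 1, g y = 0 & g (star y) = E 0 1].
  apply: univ_alg_hom; rewrite ?mulr0 ?oppr0 //.
  by rewrite exprZn sqrCi expr2 EE mulr1n -scalerAr EE mulr1n scaleN1r.
have mul2 (M N : 'M[C]_2) i j : (M * N) i j = M i 0 * N 0 j + M i 1 * N 1 j.
  rewrite -mulmxE mxE !big_ord_recl big_ord0 addr0.
  by congr (_ + M i _ * N _ j); apply/val_inj.
have triangular a : [/\ f a 1 0 = 0, f a 1 1 = eps a, g a 1 0 = 0,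
    g a 0 0 = eps a & g a 1 1 = f a 0 0].
  elim/univ_alg_ind: a.
  - by rewrite fx gx !mxE eqxx /= !mulr0 eps_x.
  - by rewrite fy gy !mxE /= eps_y.
  - by rewrite fy' gy' !mxE /= eps_star_y.
  - move=> c; rewrite (characterZ eps_char) (character_one eps_char).
    have -> : f c%:A = c%:A by rewrite (GRing.scalable_linear flin) f1.
    have -> : g c%:A = c%:A by rewrite (GRing.scalable_linear glin) g1.
    by rewrite !mxE /= !mulr0.
  - move=> a b [f0 f2 g0 g2 e] [f0' f2' g0' g2' e'].
    rewrite -[a]scale1r flin glin !scale1r !mxE (characterD eps_char).
    by rewrite f0 f0' g0 g0' f2 f2' g2 g2' e e' addr0.
  - move=> a b [f0 f2 g0 g2 e] [f0' f2' g0' g2' e'].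
    rewrite fM gM !mul2 (character_mul eps_char).
    by rewrite f0 f0' g0 g0' f2 f2' g2 g2' e e' !mul0r !mulr0 !addr0 !add0r.
exists (fun a => f a 0 0), (fun a => f a 0 1), (fun a => g a 0 1); split.
- by move=> c a b; rewrite flin !mxE.
- by move=> c a b; rewrite glin !mxE.
- by move=> a b; rewrite fM mul2; case: (triangular b) => _ ->.
- move=> a b; rewrite gM mul2; case: (triangular a) => _ _ _ -> _.
  by case: (triangular b) => _ _ _ _ ->.
- by rewrite fy gy' !mxE.
Qed.

(** The twist by [chi] cancels in the cup product of [theta] and [eta], which is
    why it is a cocycle for [eps] on both sides. *)
Lemma hochschild_H2_neq0 : hochschild_H2 eps <> [set hochschild_H2_zero eps].
Proof.
have [chi [eta [theta [lin_eta lin_theta etaM thetaM [theta1 eta1]]]]] :=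
  twisted_derivations.
pose phi a b := theta a * eta b.
have Zphi : hochschild_Z2 eps phi.
  split.
  - by move=> b c u v; rewrite /phi lin_theta mulrDl mulrA.
  - by move=> a c u v; rewrite /phi lin_eta mulrDr mulrCA.
  - move=> a b c; rewrite /phi etaM thetaM; ring.
move=> H2; have : hochschild_H2 eps (hochschild_class eps phi) by exists phi.
rewrite H2 => /= class_phi.
have : hochschild_class eps phi phi.
  exists (fun _ _ => 0); last by apply: funext => a; apply: funext => b; rewrite addr0.
  exists (fun _ => 0); first by move=> c a b; rewrite mulr0 addr0.
  by move=> a b; rewrite mulr0 mul0r subr0 addr0.
rewrite class_phi => -[beta [psi psi_lin betaE] phiE].
have := congr1 (fun h => h (star y) y) phiE.
rewrite /phi theta1 eta1 add0r betaE eps_star_y eps_y mul0r mulr0 addr0 sub0r mulr1.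
have [_ _ ->] := gen_relations C.
have -> : psi 0 = 0.
  by have := psi_lin (-1) 0 0; rewrite scaler0 addr0 mulN1r addNr.
by move/eqP; rewrite oppr0 eq_sym oner_eq0.
Qed.
End NontrivialCocycle.

(** * Schurmann triples *)

Section DropConstantTerm.
Variable F : comNzRingType.
Implicit Types p q : {poly F}.

Lemma poly_drop1 p : p = drop_poly 1 p * 'X + (p`_0)%:P.
Proof.
rewrite -{1}(poly_take_drop 1 p) addrC expr1; congr (_ + _).
by apply/polyP => -[|i]; rewrite coef_take_poly coefC.
Qed.

Lemma drop1M p q :
  drop_poly 1 (p * q) = p * drop_poly 1 q + q`_0 *: drop_poly 1 p.
Proof.
rewrite {1}(poly_drop1 q) mulrDr mulrA -[X in _ * X + _]expr1.
by rewrite drop_polyD drop_polyMXn_id [p * _%:P]mulrC mul_polyC drop_polyZ.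
Qed.
End DropConstantTerm.

Section CompletingCocycles.
Variables (C : numClosedFieldType) (eps : univ_alg C -> C).
Hypotheses (eps_char : is_character eps).
Hypotheses (eps_x : eps (gen_x C) = 0) (eps_y : eps (gen_y C) = 0).
Local Notation A := (univ_alg C).
Local Notation x := (gen_x C).
Local Notation y := (gen_y C).

Variables (D : lmodType C) (ip : {dot D for Num.conj}).
Variables (pi : A -> D -> D) (eta : A -> D).
Hypotheses (rep : is_star_rep ip pi) (cocycle : is_cocycle eps pi eta).
Local Notation dot := (inner ip).

HB.instance Definition _ a :=
  GRing.isLinear.Build C D D *:%R (pi a) (rep_op_linear rep a).
HB.instance Definition _ :=
  GRing.isLinear.Build C A D *:%R eta (cocycle_linear cocycle).
HB.instance Definition _ :=
  GRing.isLinear.Build C A C *%R eps (character_scalar eps_char).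

Local Lemma innerC u v : dot u v = (dot v u)^*.
Proof. by rewrite /inner hermC expr0 mul1r. Qed.
Local Lemma innerDr u v w : dot u (v + w) = dot u v + dot u w.
Proof. exact: linearDl. Qed.
Local Lemma innerDl u v w : dot (u + v) w = dot u w + dot v w.
Proof. exact: linearDr. Qed.
Local Lemma innerZr c u v : dot u (c *: v) = c * dot u v.
Proof. exact: linearZl_LR. Qed.
Local Lemma innerZl c u v : dot (c *: u) v = c^* * dot u v.
Proof. exact: linearZr_LR. Qed.
Local Lemma inner0r u : dot u 0 = 0.
Proof. exact: linear0l. Qed.
Local Lemma inner0l u : dot 0 u = 0.
Proof. exact: linear0r. Qed.
Local Lemma innerNr u v : dot u (- v) = - dot u v.
Proof. exact: linearNl. Qed.

Local Lemma etaM a b : eta (a * b) = pi a (eta b) + eps b *: eta a.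
Proof. exact: cocycle_mul cocycle a b. Qed.
Local Lemma eta1 : eta 1 = 0.
Proof.
have := etaM 1 1; rewrite mulr1 (character_one eps_char) scale1r (rep_one rep).
by move/eqP; rewrite -subr_eq subrr => /eqP.
Qed.
Local Lemma piD a b u : pi (a + b) u = pi a u + pi b u.
Proof. by rewrite -[a]scale1r (rep_linear rep) !scale1r. Qed.
Local Lemma pi0 u : pi 0 u = 0.
Proof. by apply: (@addIr _ (pi 0 u)); rewrite -piD !add0r. Qed.

Local Lemma rep_adjointr a u v : dot u (pi a v) = dot (pi (star a) u) v.
Proof. by rewrite (rep_adjoint rep) starK. Qed.

(** [<pi y u, pi y u> = <u, pi (star y * y) u> = 0]. *)
Lemma pi_y u : pi y u = 0.
Proof.
apply/eqP; rewrite -(dnorm_eq0 ip) -[ip _ _]/(inner ip _ _) (rep_adjoint rep).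
by rewrite -(rep_mul rep); have [_ _ ->] := gen_relations C; rewrite pi0 inner0r.
Qed.

Lemma pi_star_y u : pi (star y) u = 0.
Proof.
apply/eqP; rewrite -(dnorm_eq0 ip) -[ip _ _]/(inner ip _ _) (rep_adjoint rep).
by rewrite starK pi_y inner0r.
Qed.

(** [0 <= <pi x (eta y), pi x (eta y)> = <eta y, pi (x ^+ 2) (eta y)>
    = - <eta y, eta y>]. *)
Lemma eta_y : eta y = 0.
Proof.
apply/eqP; rewrite -(dnorm_eq0 ip) -[ip _ _]/(inner ip _ _).
rewrite eq_le dnorm_ge0 andbT.
have [_ x2y _] := gen_relations C.
have e : pi x (pi x (eta y)) = - eta y.
  have := etaM (x ^+ 2) y.
  by rewrite x2y linearN eps_y scale0r addr0 expr2 (rep_mul rep).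
have := dnorm_ge0 ip (pi x (eta y)); rewrite -[ip _ _]/(inner ip _ _).
by rewrite (rep_adjoint rep) star_gen_x e innerNr oppr_ge0.
Qed.

Lemma eta_star_y : eta (star y) = 0.
Proof.
have e : star y * x ^+ 2 = - star y.
  have [_ x2y _] := gen_relations C.
  have := congr1 star x2y.
  by rewrite starM expr2 starM star_gen_x star_opp -expr2.
have := congr1 eta e; rewrite etaM pi_star_y expr2 (character_mul eps_char).
by rewrite eps_x mul0r scale0r addr0 linearN => /eqP; rewrite eq_sym oppr_eq0 => /eqP.
Qed.

(* [symbol] is the star-homomorphism that sends [x] to the variable and [y] to 0;
   evaluation at [x] is a section of it. *)
Variable symbol : A -> {poly C}.
Hypotheses (symbol_hom : is_unital_star_hom symbol).
Hypotheses (symbol_x : symbol x = 'X) (symbol_y : symbol y = 0).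
HB.instance Definition _ :=
  GRing.isLinear.Build C A {poly C} *:%R symbol (star_hom_linear symbol_hom).

Local Notation at_x := (horner_alg x).

Lemma star_at_x p : star (at_x p) = at_x (star p).
Proof.
elim/poly_ind: p => [|p c IH]; first by rewrite rmorph0 !star_zero rmorph0.
have -> : star (p * 'X + c%:P) = 'X * star p + (c^*)%:P.
  by rewrite starD starM [star 'X]map_polyX [star c%:P]map_polyC.
rewrite !rmorphD !rmorphM starD starM IH /= !horner_algC horner_algX.
by rewrite starZ star1 star_gen_x.
Qed.

(** The retraction of the algebra onto the subalgebra generated by [x], which
    kills [y], is not seen by [eps], [pi] and [eta]. *)
Lemma at_x_symbol a :
  [/\ eps (at_x (symbol a)) = eps a, forall u, pi (at_x (symbol a)) u = pi a u
    & eta (at_x (symbol a)) = eta a].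
Proof.
elim/univ_alg_ind: a.
- by rewrite symbol_x horner_algX.
- rewrite symbol_y !rmorph0 !linear0 eps_y eta_y.
  by split=> // u; rewrite pi0 pi_y.
- rewrite (star_hom_star symbol_hom) symbol_y star_zero !rmorph0 !linear0.
  rewrite (eps_star_y eps_char eps_y) eta_star_y.
  by split=> // u; rewrite pi0 pi_star_y.
- move=> c; rewrite linearZ /= (star_hom_one symbol_hom).
  by rewrite linearZ /= rmorph1 mulr_algl.
- move=> a b [ea pa ta] [eb pb tb]; rewrite !linearD /= ea eb ta tb.
  by split=> // u; rewrite !piD pa pb.
- move=> a b [ea pa ta] [eb pb tb]; rewrite (star_hom_mul symbol_hom) rmorphM.
  rewrite !(character_mul eps_char) !etaM ea eb ta tb pa.
  by split=> // u; rewrite !(rep_mul rep) pb pa.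
Qed.

(** The algebra is not commutative, but its image under [symbol] is. *)
Lemma eta_x_comm a : eta (x * a) = eta (a * x).
Proof.
have [_ _ <-] := at_x_symbol (x * a); have [_ _ <-] := at_x_symbol (a * x).
by rewrite !(star_hom_mul symbol_hom) mulrC.
Qed.

Lemma pi_eta_x a : pi a (eta x) = pi x (eta a) + eps a *: eta x.
Proof. by rewrite -etaM eta_x_comm etaM eps_x scale0r addr0. Qed.

(** The symmetry behind the hermitian property of [potential].  For products it
    follows from [pi_eta_x], applied once to each factor. *)
Lemma inner_eta_x a : dot (eta (star a)) (eta x) = dot (eta x) (eta a).
Proof.
elim/univ_alg_ind: a.
- by rewrite star_gen_x.
- by rewrite eta_star_y eta_y inner0l inner0r.
- by rewrite starK eta_star_y eta_y inner0l inner0r.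
- by move=> c; rewrite starZ star1 !linearZ /= eta1 !scaler0 inner0l inner0r.
- by move=> a b IHa IHb; rewrite starD !linearD innerDl innerDr IHa IHb.
- move=> a b IHa IHb; rewrite starM !etaM innerDl innerDr innerZl innerZr.
  rewrite (rep_adjoint rep) starK pi_eta_x innerDr innerZr IHa IHb.
  rewrite (character_star eps_char) conjCK.
  rewrite [dot (eta x) (pi a _)]rep_adjointr [dot _ (pi x _)]rep_adjointr.
  rewrite star_gen_x pi_eta_x innerDl innerZl (character_star eps_char) conjCK; ring.
Qed.

(** Up to the kernel of [symbol], this is the quotient of [a - eps a] by [x]. *)
Definition quotient_x a : A := at_x (drop_poly 1 (symbol a)).

Lemma eps_symbol a : eps a = (symbol a)`_0.
Proof.
have [<- _ _] := at_x_symbol a; rewrite {1}(poly_drop1 (symbol a)).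
rewrite rmorphD rmorphM /= horner_algX horner_algC linearD linearZ /=.
rewrite (character_mul eps_char) eps_x (character_one eps_char).
by rewrite mulr0 mulr1 add0r.
Qed.

Lemma at_x_symbolE a : at_x (symbol a) = quotient_x a * x + eps a *: 1.
Proof.
rewrite eps_symbol {1}(poly_drop1 (symbol a)).
by rewrite rmorphD rmorphM /= horner_algX horner_algC.
Qed.

Lemma quotient_x_mul a b :
  quotient_x (a * b) = at_x (symbol a) * quotient_x b + eps b *: quotient_x a.
Proof.
rewrite /quotient_x (star_hom_mul symbol_hom) drop1M eps_symbol.
by rewrite rmorphD rmorphM /= linearZ /= mulr_algl.
Qed.

Definition potential a : C := dot (eta x) (eta (quotient_x a)).

Lemma potential_schurmann : is_schurmann_triple eps ip pi eta potential.
Proof.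
split=> //.
- move=> c a b; rewrite /potential /quotient_x linearP drop_polyD drop_polyZ.
  by rewrite rmorphD /= linearZ /= mulr_algl linearP innerDr innerZr.
- move=> a; rewrite /potential /quotient_x (star_hom_star symbol_hom).
  have -> : drop_poly 1 (star (symbol a)) = star (drop_poly 1 (symbol a)).
    by apply/polyP => i; rewrite coef_drop_poly !coef_map coef_drop_poly.
  by rewrite -star_at_x -inner_eta_x starK innerC.
- move=> a b; rewrite /potential quotient_x_mul linearD linearZ /= etaM.
  rewrite innerDr innerDr !innerZr.
  have [_ pa ta] := at_x_symbol a; rewrite pa ta.
  have etaE : eta b = pi x (eta (quotient_x b)) + eps (quotient_x b) *: eta x.
    have [_ _ <-] := at_x_symbol b; rewrite at_x_symbolE linearD linearZ /= eta1.
    by rewrite scaler0 addr0 -eta_x_comm etaM.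
  rewrite etaE innerDr innerZr inner_eta_x.
  have -> : dot (eta (star a)) (pi x (eta (quotient_x b))) =
      dot (eta x) (pi a (eta (quotient_x b))) - eps a * dot (eta x) (eta (quotient_x b)).
    rewrite [dot (eta x) _]rep_adjointr pi_eta_x innerDl innerZl.
    by rewrite (character_star eps_char) conjCK (rep_adjoint rep) star_gen_x addrK.
  ring.
Qed.

End CompletingCocycles.

Lemma polynomial_symbol (C : numClosedFieldType) :
  exists f : univ_alg C -> {poly C},
    is_unital_star_hom f /\ (f (gen_x C) = 'X /\ f (gen_y C) = 0).
Proof.
have relX : relations ('X : {poly C}) 0.
  by split; rewrite ?mulr0 ?oppr0 //; exact: map_polyX.
by have [f [fP _]] := univ_alg_universal relX; exists f.
Qed.

Theorem mainTheorem6 (R : realType) (eps : univ_alg R[i] -> R[i])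
    (eps_char : is_character eps)
    (eps_x : eps (gen_x R[i]) = 0) (eps_y : eps (gen_y R[i]) = 0) :
  property_AC eps /\ hochschild_H2 eps <> [set hochschild_H2_zero eps].
Proof.
split; last exact: hochschild_H2_neq0.
move=> D ip pi eta rep cocycle.
have [f [f_hom [fx fy]]] := polynomial_symbol R[i].
exists (potential ip eta f).
exact: potential_schurmann.
Qed.
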